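(* Let $k$ be a positive integer and let $n\geq 34k^3$. If $G$ is a connected graph with $n$ vertices and at most $n\left(1+\frac{1}{119k^2+62k}\right)$ edges, then $r(G,B_k)=2n-1$.
   Context: For graphs $G,H$, the Ramsey number $r(G,H)$ is the smallest positive integer $N$ such that every red-blue coloring of the edges of the complete graph $K_N$ contains a red subgraph isomorphic to $G$ or a blue subgraph isomorphic to $H$. The book $B_k$ is the graph $K_2+\overline{K}_k$ on $k+2$ vertices, i.e. an edge together with $k$ further vertices each adjacent to both endpoints of that edge (equivalently $k$ triangles sharing a common edge). All graphs are finite and simple. *)

(* Defs.v *)
From mathcomp Require Import all_boot all_order all_algebra.

Set Implicit Arguments.
Unset Strict Implicit.
Unset Printing Implicit Defensive.

Record sgraph := SGraph {
  vertex :> finType;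
  adj : rel vertex;
  adj_sym : symmetric adj;
  adj_irr : irreflexive adj }.

Arguments adj {s} x y.

Definition edges (G : sgraph) : {set {set G}} :=
  [set e | [exists x, exists y, adj x y && (e == [set x; y])]].

Definition connected (G : sgraph) : Prop :=
  0 < #|G| /\ forall x y : G, connect adj x y.

(* H has a (not necessarily induced) subgraph isomorphic to G: such a subgraph
   is the image of an injective, adjacency-preserving map. *)
Definition contains_copy (G H : sgraph) : Prop :=
  exists2 f : G -> H, injective f & forall x y : G, adj x y -> adj (f x) (f y).

Section Complete.
Variable N : nat.
Definition complete_adj : rel 'I_N := fun x y => x != y.
Lemma complete_sym : symmetric complete_adj.
Proof. by move=> x y; rewrite /complete_adj eq_sym. Qed.
Lemma complete_irr : irreflexive complete_adj.
Proof. by move=> x; rewrite /complete_adj eqxx. Qed.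
Definition complete : sgraph := SGraph complete_sym complete_irr.
End Complete.

Section Complement.
Variable G : sgraph.
Definition compl_adj : rel G := fun x y => (x != y) && ~~ adj x y.
Lemma compl_sym : symmetric compl_adj.
Proof. by move=> x y; rewrite /compl_adj eq_sym adj_sym. Qed.
Lemma compl_irr : irreflexive compl_adj.
Proof. by move=> x; rewrite /compl_adj eqxx. Qed.
Definition compl : sgraph := SGraph compl_sym compl_irr.
End Complement.

Section Join.
Variables G H : sgraph.
Definition join_adj : rel (G + H)%type := fun u v =>
  match u, v with
  | inl x, inl y => adj x y
  | inr x, inr y => adj x y
  | _, _ => true
  end.
Lemma join_sym : symmetric join_adj.
Proof. by move=> [x|x] [y|y] //=; rewrite adj_sym. Qed.
Lemma join_irr : irreflexive join_adj.
Proof. by move=> [x|x] /=; rewrite adj_irr. Qed.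
Definition join : sgraph := SGraph join_sym join_irr.
End Join.

Definition book (k : nat) : sgraph := join (complete 2) (compl (complete k)).

(* A red-blue colouring of the edges of K_N is given by c : {set 'I_N} -> bool,
   with true for red and false for blue; only the values of c at the edges,
   i.e. the two-element sets, matter. *)
Section Colouring.
Variables (N : nat) (c : {set 'I_N} -> bool).
Definition colour_adj (b : bool) : rel (complete N) :=
  fun x y => adj x y && (c [set x; y] == b).
Lemma colour_sym b : symmetric (colour_adj b).
Proof. by move=> x y; rewrite /colour_adj adj_sym setUC. Qed.
Lemma colour_irr b : irreflexive (colour_adj b).
Proof. by move=> x; rewrite /colour_adj adj_irr. Qed.
Definition red_graph : sgraph := SGraph (colour_sym true) (colour_irr true).
Definition blue_graph : sgraph := SGraph (colour_sym false) (colour_irr false).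
End Colouring.

Definition arrows (N : nat) (G H : sgraph) : Prop :=
  forall c : {set 'I_N} -> bool,
    contains_copy G (red_graph c) \/ contains_copy H (blue_graph c).

(* r(G, H) = N *)
Definition is_ramsey_number (G H : sgraph) (N : nat) : Prop :=
  [/\ 0 < N, arrows N G H & forall M, 0 < M -> arrows M G H -> N <= M].

(* Main.v *)
Require Import Defs.
From mathcomp Require Import all_boot all_order all_algebra.
From mathcomp Require Import zify.

(* Upper bound.  Fix a colouring of K_(2n-1) without a blue B_k.  The blue
   neighbourhood of a vertex then has blue degrees below k, so a sparse graph
   can be embedded greedily in the red graph on it.  By induction on the number
   m <= n of vertices, every connected graph H on m vertices with at most m + q
   edges is red, where q is the excess of G.
   - If m is small, embed H vertex by vertex in the order given by minimum
     degrees; a failure exhibits a large blue neighbourhood.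
   - If H has a suspended path with 3k interior vertices, shorten it by one
     vertex.  At least n vertices are left outside the copy of the shorter
     graph: either they span a red clique, or two of them form a blue edge, and
     one of these two can be inserted in the path.
   - Otherwise H has many leaves.  Remove one; if the copy of the rest does not
     extend, the at least n vertices outside it form a blue neighbourhood.
     When H almost fills it, either a vertex with 2(k-1) leaves can be placed so
     that red edges to the outside compensate its blue edges inside, or the
     leaves are so spread that the last ones can be placed by swapping.
   Lower bound: two disjoint red cliques on at most n - 1 vertices each. *)

Set Implicit Arguments.
Unset Strict Implicit.
Unset Printing Implicit Defensive.
Import Order.TTheory GRing.Theory Num.Theory.

(** * Finite graphs on a vertex set, leaves and suspended paths *)

Lemma uniq_subset_leq_card (T : finType) (s : seq T) (A : {set T}) :
  uniq s -> {subset s <= A} -> size s <= #|A|.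
Proof. by move=> us sA; rewrite -(card_uniqP us) subset_leq_card //; apply/subsetP. Qed.

Lemma leq_card_cover_by (T I : finType) (A : {set T}) (J : {set I}) (F : I -> {set T}) :
  (forall a, a \in A -> exists2 i, i \in J & a \in F i) ->
  #|A| <= \sum_(i in J) #|F i|.
Proof.
move=> AF; apply: (@leq_trans (\sum_(a in A) \sum_(i in J) (a \in F i : nat))).
  rewrite -sum1_card; apply: leq_sum => a /AF [i Ji ai].
  by rewrite (bigD1 i) //= ai.
rewrite exchange_big /=; apply: leq_sum => i _.
rewrite -big_mkcondr /= sum1_card subset_leq_card //.
by apply/subsetP => a /andP[].
Qed.

Section Graph.
Variable T : finType.
Implicit Types (e : rel T) (U K L : {set T}) (u v w : T).

(* Graphs are pairs [(e, U)] of a relation and a vertex set, so that deleting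
   and suppressing vertices does not change the ambient type. *)
Definition nbr e U u : {set T} := [set w in U | e u w].

Definition degsum e U := \sum_(u in U) #|nbr e U u|.

Definition cut_connected e U := forall K, K \subset U -> K != set0 ->
  (forall u w, u \in K -> w \in U -> e u w -> w \in K) -> K = U.

Definition sparse q e U := forall K, K \subset U -> degsum e K <= 2 * (#|K| + q).

Definition leaves e U : {set T} := [set l in U | #|nbr e U l| == 1].

Definition deg2 e U : {set T} := [set v in U | #|nbr e U v| == 2].

Lemma nbrS e U K u : K \subset U -> nbr e K u \subset nbr e U u.
Proof. by move=> /subsetP KU; apply/subsetP => w; rewrite !inE => /andP[/KU -> ->]. Qed.

Lemma nbr_setD1 e U v u : nbr e (U :\ v) u = nbr e U u :\ v.
Proof. by apply/setP => w; rewrite !inE andbA. Qed.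

Lemma degsum_setD1 e U v : symmetric e -> irreflexive e -> v \in U ->
  degsum e U = degsum e (U :\ v) + 2 * #|nbr e U v|.
Proof.
move=> es ei Uv; rewrite /degsum (big_setD1 v) //=.
have -> : \sum_(u in U :\ v) #|nbr e U u| =
    \sum_(u in U :\ v) (e v u + #|nbr e (U :\ v) u|).
  apply: eq_bigr => u; rewrite !inE => /andP[_ Uu].
  by rewrite nbr_setD1 (cardsD1 v) inE Uv /= es.
rewrite big_split /=.
suff -> : \sum_(u in U :\ v) (e v u : nat) = #|nbr e U v| by lia.
rewrite -big_mkcondr /= sum1_card; apply: eq_card => u; rewrite unfold_in !inE.
by case: eqVneq => [->|]; rewrite ?ei ?andbF.
Qed.

Lemma degsum_le e U K : symmetric e -> irreflexive e -> K \subset U ->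
  degsum e K <= degsum e U.
Proof.
move=> es ei KU; rewrite /degsum [leqRHS](big_setID K) /= (setIidPr KU).
apply: leq_trans (leq_addr _ _).
by apply: leq_sum => u _; rewrite subset_leq_card // nbrS.
Qed.

Lemma not_cut_closed e U K : cut_connected e U -> K \proper U -> K != set0 ->
  exists u w, [/\ u \in K, w \in U :\: K & e u w].
Proof.
move=> ec KU K0.
have [/existsP [u /existsP [w /and3P[uK wU euw]]]|ne] :=
  boolP [exists u, exists w, [&& u \in K, w \in U :\: K & e u w]].
  by exists u, w.
have KE : K = U.
  apply: ec (proper_sub KU) K0 _ => u w uK wU euw; apply: contraR ne => wK.
  by apply/existsP; exists u; apply/existsP; exists w; rewrite uK euw inE wK wU.
by move: KU; rewrite KE properxx.
Qed.

Lemma cut_connected_sparse q e U : symmetric e -> irreflexive e ->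
  cut_connected e U -> degsum e U <= 2 * (#|U| + q) -> sparse q e U.
Proof.
move=> es ei ec eU K KU.
have [->|K0] := eqVneq K set0; first by rewrite /degsum big_set0.
have [m mE] := ubnP (#|U| - #|K|); elim: m K KU K0 mE => // m IH K KU K0 mE.
have [->//|KnU] := eqVneq K U.
have KpU : K \proper U by rewrite properEneq KnU.
have [u [w [uK wU euw]]] := not_cut_closed ec KpU K0.
move: wU; rewrite inE => /andP[wK wU].
have cK : #|w |: K| = #|K|.+1 by rewrite cardsU1 wK.
have lt := proper_card KpU.
have := IH (w |: K); rewrite cK subUset sub1set wU KU => /(_ isT) IHw.
have /IHw {IHw} : w |: K != set0 by rewrite -card_gt0 cK.
rewrite (@degsum_setD1 _ _ w es ei) ?setU11 // setU1K //.
have : 0 < #|nbr e (w |: K) w|.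
  by rewrite card_gt0; apply/set0Pn; exists u; rewrite !inE uK orbT es euw.
lia.
Qed.

Lemma sparseS q e U K : K \subset U -> sparse q e U -> sparse q e K.
Proof. by move=> KU eU L LK; apply: eU; apply: subset_trans KU. Qed.

Lemma nbr_gt0 e U v : irreflexive e -> cut_connected e U -> v \in U -> 1 < #|U| ->
  0 < #|nbr e U v|.
Proof.
move=> ei ec Uv U1; rewrite card_gt0.
have KU : [set v] \proper U by rewrite properEcard sub1set Uv cards1.
have [|u [w [/set1P -> ]]] := not_cut_closed ec KU; first by rewrite -card_gt0 cards1.
rewrite !inE => /andP[_ wU] evw; apply/set0Pn; exists w; by rewrite inE wU.
Qed.

Lemma cut_connected_leaf e U l : symmetric e -> cut_connected e U -> l \in leaves e U ->
  cut_connected e (U :\ l).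
Proof.
move=> es ec; rewrite inE => /andP[Ul /cards1P [p pE]] K KU K0 Kc.
have Knl : l \notin K by apply: contraTN KU => lK; apply/subsetPn; exists l => //; rewrite !inE eqxx.
have KU' : K \subset U by apply: subset_trans KU (subsetDl _ _).
have nl w : w \in U -> e l w -> w = p.
  by move=> wU elw; apply/set1P; rewrite -pE inE wU.
have [pK|pK] := boolP (p \in K); last first.
  have KE := ec _ KU' K0; suff KU2 : K = U by rewrite -KU2 in Ul; rewrite Ul in Knl.
  apply: KE => u w uK wU euw; have [wl|wl] := eqVneq w l.
    have := nl u (subsetP KU' _ uK); rewrite es -wl => /(_ euw) uE.
    by rewrite -uE uK in pK.
  by apply: (Kc u w) => //; rewrite !inE wl.
suff <- : l |: K = U by rewrite setU1K.
apply: ec; first by rewrite subUset sub1set Ul.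
  by apply/set0Pn; exists l; rewrite setU11.
move=> u w; rewrite !inE => /orP[/eqP ->|uK] wU euw; first by rewrite (nl w) // pK orbT.
by case: eqVneq => //= wl; apply: (Kc u w) => //; rewrite !inE wl.
Qed.

Lemma degsum_leaf e U l q : symmetric e -> irreflexive e -> l \in leaves e U ->
  degsum e U <= 2 * (#|U| + q) -> degsum e (U :\ l) <= 2 * (#|U :\ l| + q).
Proof.
move=> es ei; rewrite inE => /andP[Ul /eqP l1].
by rewrite (@degsum_setD1 _ _ l) // l1 (cardsD1 l U) Ul; lia.
Qed.

Lemma card_nbr_ge3 e U u a b c : uniq [:: a; b; c] -> a \in U -> b \in U -> c \in U ->
  e u a -> e u b -> e u c -> 3 <= #|nbr e U u|.
Proof.
move=> abc aU bU cU ea eb ec; apply: (uniq_subset_leq_card abc) => x.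
by rewrite !inE => /or3P[] /eqP ->; rewrite ?aU ?bU ?cU.
Qed.

Definition deg2_adj e U : rel T :=
  fun u w => [&& u \in deg2 e U, w \in deg2 e U & e u w].

Lemma deg2_adj_sym e U : symmetric e -> symmetric (deg2_adj e U).
Proof. by move=> es u w; rewrite /deg2_adj es andbCA. Qed.

(* A connected set of vertices of degree two is a path or a cycle, so a path
   inside it can be prolonged at one of its ends until it exhausts it. *)
Lemma deg2_long_path e U x r : symmetric e -> x \in deg2 e U ->
  r < #|[set u | connect (deg2_adj e U) x u]| ->
  exists y p, [/\ path e y p, uniq (y :: p), {subset y :: p <= deg2 e U} & size p = r].
Proof.
move=> es xD rC; set e2 := deg2_adj e U in rC.
have e2S : symmetric e2 := deg2_adj_sym U es.
have e2s : connect_sym e2 := sym_connect_sym e2S.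
suff [y [p [pe up xp pD sp]]] : exists y p, [/\ path e2 y p, uniq (y :: p), x \in y :: p,
    {subset y :: p <= deg2 e U} & size p = r].
  exists y, p; split=> //; by apply: sub_path pe => u w /and3P[].
elim: r rC => [|r IH] rC.
  by exists x, [::]; split; rewrite ?mem_head // => u; rewrite inE => /eqP ->.
have [y [p [pe up xp pD sp]]] := IH (ltnW rC).
have [/existsP [u /existsP [w /and3P[uK wU euw]]]|ne] :=
    boolP [exists u, exists w, [&& u \in y :: p, w \notin y :: p & e2 u w]]; last first.
  have cl : closed e2 (mem (y :: p)).
    apply: intro_closed => // u w euw uK; apply: contraR ne => wK.
    by apply/existsP; exists u; apply/existsP; exists w; rewrite uK euw wK.
  have : #|[set u | connect e2 x u]| <= size (y :: p).
    rewrite -(card_uniqP up) subset_leq_card //; apply/subsetP => u; rewrite inE => xu.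
    by rewrite -(closed_connect cl xu).
  by move=> /leq_trans /(_ (leqnn _)); rewrite /= sp; lia.
have wD : w \in deg2 e U by case/and3P: euw.
have uD : u \in deg2 e U by case/and3P: euw.
have pD' z s : z \in deg2 e U -> {subset s <= deg2 e U} -> {subset z :: s <= deg2 e U}.
  by move=> zD sD t; rewrite inE => /orP[/eqP ->//|/sD].
have [uy|uny] := eqVneq u y.
  exists w, (y :: p); split=> //=; rewrite -?uy ?sp //.
  - by rewrite e2S euw; rewrite uy.
  - by rewrite uy wU.
  - by rewrite uy inE xp orbT.
  - by apply: pD' => //; rewrite uy.
move: uK; rewrite inE (negPf uny) /= => uK.
have [ul|unl] := eqVneq u (last y p).
  exists y, (rcons p w); split.
  - by rewrite rcons_path pe -ul.
  - by have : uniq (rcons (y :: p) w) by rewrite rcons_uniq wU.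
  - by have : x \in rcons (y :: p) w by rewrite mem_rcons inE xp orbT.
  - by move=> z zp; apply: (pD' w (y :: p)) => //; rewrite -mem_rcons rcons_cons.
  - by rewrite size_rcons sp.
case/splitPr: uK pe up xp pD sp wU unl => p1 p2.
case: p2 => [|b p2]; first by rewrite last_cat /= eqxx.
move=> + up xp pD sp wU unl; rewrite cat_path => /andP[_ /and3P[eau eub _]].
suff : 3 <= #|nbr e U u| by move: uD; rewrite inE => /andP[_ /eqP ->].
have inU z : z \in deg2 e U -> z \in U by rewrite inE => /andP[].
have la : last y p1 \in y :: p1 by apply: mem_last.
have bp : b \in y :: p1 ++ [:: u, b & p2] by rewrite inE mem_cat !inE eqxx !orbT.
have ap : last y p1 \in y :: p1 ++ [:: u, b & p2] by rewrite -cat_cons mem_cat la.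
apply: (@card_nbr_ge3 _ _ _ (last y p1) b w).
- rewrite /= !inE !andbT negb_or -andbA; apply/and3P; split.
  + apply: contraTneq up => ab; rewrite -cat_cons cat_uniq.
    by rewrite negb_and; apply/orP; right; rewrite negb_and; apply/orP; left;
       rewrite negbK; apply/hasP; exists b; rewrite ?inE ?eqxx ?orbT //= -ab.
  + by apply: contraNneq wU => <-.
  + by apply: contraNneq wU => <-.
- by apply/inU/pD.
- by apply/inU/pD.
- exact: inU.
- by rewrite es; case/and3P: eau.
- by case/and3P: eub.
- by case/and3P: euw.
Qed.

(* The components of the graph induced by the vertices of degree two have fewer
   than [r] vertices, and each is joined to some vertex of another degree;
   hence few vertices of degree two.  Those of degree at least three are
   bounded by the leaves through the degree sum. *)
Lemma card_le_of_no_long_path e U q r : symmetric e -> irreflexive e -> cut_connected e U ->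
  1 < #|U| -> r <= #|U| -> degsum e U <= 2 * (#|U| + q) -> 0 < r ->
  (forall y p, path e y p -> uniq (y :: p) -> {subset y :: p <= deg2 e U} -> size p = r.-1 -> False) ->
  #|U| <= (2 * r - 1) * (2 * #|leaves e U| + 3 * q).
Proof.
move=> es ei ec U1 rU eU r0 noP.
pose e2 := deg2_adj e U.
pose C x := [set u | connect e2 x u].
have e2s : connect_sym e2 := sym_connect_sym (deg2_adj_sym U es).
have cC x : x \in deg2 e U -> #|C x| <= r.-1.
  move=> xD; rewrite leqNgt; apply/negP => lt.
  by have [y [p [pe up pD sp]]] := deg2_long_path es xD lt; apply: noP pe up pD sp.
have CD x : x \in deg2 e U -> C x \subset deg2 e U.
  move=> xD; apply/subsetP => u; rewrite inE => xu.
  have cl : closed e2 (mem (deg2 e U)) by apply: intro_closed => // a b /and3P[].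
  by have := closed_connect cl xu; rewrite /= => <-.
have DU : deg2 e U \subset U by apply/subsetP => u; rewrite inE => /andP[].
pose W := U :\: deg2 e U.
pose X := [set x in deg2 e U | [exists w in W, e x w]].
have XW : #|X| <= \sum_(w in W) #|nbr e U w|.
  apply: leq_card_cover_by => x; rewrite inE => /andP[xD /existsP [w /andP[wW exw]]].
  by exists w => //; rewrite inE (subsetP DU _ xD) es.
have DX : #|deg2 e U| <= #|X| * r.-1.
  rewrite -sum_nat_const; apply: (@leq_trans (\sum_(x in X) #|C x|)); last first.
    by apply: leq_sum => x; rewrite inE => /andP[xD _]; apply: cC.
  apply: leq_card_cover_by => v vD.
  have CU : C v \proper U.
    rewrite properEcard (subset_trans (CD v vD) DU) /=.
    by have := cC v vD; lia.
  have vC : v \in C v by rewrite inE connect0.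
  have [|u [w [uC wU euw]]] := not_cut_closed ec CU.
    by apply/set0Pn; exists v.
  move: wU; rewrite inE => /andP[wC wU].
  have uD := subsetP (CD v vD) _ uC.
  exists u; last by move: uC; rewrite !inE e2s.
  rewrite inE uD; apply/existsP; exists w; rewrite euw andbT inE wU andbT.
  apply: contra wC => wD; move: uC; rewrite !inE => vu.
  by apply: connect_trans vu _; apply: connect1; rewrite /e2 /deg2_adj uD wD.
have dE : degsum e U = 2 * #|deg2 e U| + \sum_(w in W) #|nbr e U w|.
  rewrite /degsum (big_setID (deg2 e U)) /= (setIidPr DU) -/W; congr (_ + _).
  rewrite mulnC -sum_nat_const; apply: eq_bigr => u.
  by rewrite inE => /andP[_ /eqP].
have cU : #|U| = #|deg2 e U| + #|W| by rewrite -(cardsID (deg2 e U) U) (setIidPr DU).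
have LW : leaves e U \subset W.
  by apply/subsetP => u; rewrite !inE => /andP[-> /eqP ->].
have W3 : #|leaves e U| + 3 * (#|W| - #|leaves e U|) <= \sum_(w in W) #|nbr e U w|.
  rewrite (big_setID (leaves e U)) /= (setIidPr LW); apply: leq_add.
    rewrite -[leqLHS]muln1 -sum_nat_const; apply: leq_sum => u.
    by rewrite inE => /andP[_ /eqP ->].
  have -> : #|W| - #|leaves e U| = #|W :\: leaves e U|.
    by have := cardsID (leaves e U) W; rewrite (setIidPr LW); lia.
  rewrite mulnC -sum_nat_const; apply: leq_sum => u; rewrite !inE.
  have [uU|] := boolP (u \in U); rewrite /= ?andbF //.
  by have := nbr_gt0 ei ec uU U1; lia.
have := subset_leq_card LW.
move: eU XW DX W3; rewrite dE cU.
move: (\sum_(w in W) _) (#|W|) (#|X|) (#|deg2 e U|) (#|leaves e U|) => S w x d l eU XW DX W3 lw.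
have xS : x * r.-1 <= (2 * (w + q)) * r.-1 by rewrite leq_mul2r; lia.
nia.
Qed.

Section Suppress.
Variables (e : rel T) (U : {set T}) (x0 x1 x2 : T).
Hypotheses (es : symmetric e) (ei : irreflexive e).
Hypotheses (U0 : x0 \in U) (U2 : x2 \in U) (U1 : x1 \in U).
Hypotheses (e01 : e x0 x1) (e12 : e x1 x2) (x02 : x0 != x2) (d1 : #|nbr e U x1| = 2).

(* The graph obtained from [e] by deleting [x1] (from the vertex set) and joining
   its two neighbours. *)
Definition suppress : rel T :=
  fun u w => [|| e u w, (u == x0) && (w == x2) | (u == x2) && (w == x0)].

Lemma suppress_sym : symmetric suppress.
Proof.
move=> u w; rewrite /suppress es; congr (_ || _).
by rewrite orbC [X in X || _]andbC [X in _ || X]andbC.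
Qed.

Lemma suppress_irr : irreflexive suppress.
Proof.
move=> u; rewrite /suppress ei /=.
by case: eqVneq => [->|] /=; rewrite ?(negPf x02) ?andbF.
Qed.

Lemma suppress_nbr w : w \in U -> e x1 w -> (w == x0) || (w == x2).
Proof.
move=> wU ew; apply: contraT; rewrite negb_or => /andP[w0 w2].
have : 3 <= #|nbr e U x1|.
  by apply: (@card_nbr_ge3 _ _ _ x0 x2 w); rewrite //= ?inE 1?es // negb_or x02 eq_sym w0 eq_sym w2.
by rewrite d1.
Qed.

Lemma degsum_suppress q : degsum e U <= 2 * (#|U| + q) ->
  degsum suppress (U :\ x1) <= 2 * (#|U :\ x1| + q).
Proof.
rewrite (@degsum_setD1 e U x1) // d1 (cardsD1 x1 U) U1 => eU.
suff : degsum suppress (U :\ x1) <= degsum e (U :\ x1) + 2 by lia.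
have one a : \sum_(u in U :\ x1) (u == a : nat) <= 1.
  rewrite -big_mkcondr /= sum1_card -(cards1 a) subset_leq_card //.
  by apply/subsetP => u /andP[_ /eqP ->]; rewrite inE.
apply: (@leq_trans (\sum_(u in U :\ x1) (#|nbr e (U :\ x1) u| + ((u == x0) + (u == x2))))).
  apply: leq_sum => u _.
  have nE : nbr suppress (U :\ x1) u \subset nbr e (U :\ x1) u :|:
      ((if u == x0 then [set x2] else set0) :|: (if u == x2 then [set x0] else set0)).
    apply/subsetP => w; rewrite !in_setU ![w \in nbr _ _ _]inE /suppress => /andP[-> /=].
    case/or3P => [->//|/andP[-> /eqP ->]|/andP[-> /eqP ->]]; by rewrite !inE eqxx ?orbT.
  apply: leq_trans (subset_leq_card nE) _.
  apply: leq_trans (leq_card_setU _ _) _; rewrite leq_add2l.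
  apply: leq_trans (leq_card_setU _ _) _; apply: leq_add; by case: ifP; rewrite ?cards1 ?cards0.
by rewrite big_split /= leq_add2l big_split /= (leq_add (one _) (one _)).
Qed.

Lemma cut_connected_suppress : cut_connected e U -> cut_connected suppress (U :\ x1).
Proof.
move=> ec K KU K0 Kc.
have KU' : K \subset U by apply: subset_trans KU (subsetDl _ _).
have K1 : x1 \notin K.
  by apply: contraTN KU => lK; apply/subsetPn; exists x1 => //; rewrite !inE eqxx.
have n01 : x0 != x1 by apply: contraTneq e01 => ->; rewrite ei.
have n21 : x2 != x1 by apply: contraTneq e12 => ->; rewrite ei.
have K02 : x0 \in K -> x2 \in K.
  by move=> k; apply: (Kc x0) => //; rewrite ?inE ?n21 // /suppress !eqxx orbT.
have K20 : x2 \in K -> x0 \in K.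
  by move=> k; apply: (Kc x2) => //; rewrite ?inE ?n01 // /suppress !eqxx !orbT.
have step u w : u \in K -> w \in U -> e u w -> w != x1 -> w \in K.
  by move=> uK wU euw w1; apply: (Kc u w) => //; rewrite ?inE ?w1 // /suppress euw.
have [x0K|x0K] := boolP (x0 \in K).
  suff <- : x1 |: K = U by rewrite setU1K.
  apply: ec; first by rewrite subUset sub1set U1.
    by apply/set0Pn; exists x1; rewrite setU11.
  move=> u w; rewrite !inE => /orP[/eqP ->|uK] wU euw.
    by have := suppress_nbr wU euw => /orP[] /eqP ->; rewrite ?x0K ?K02 ?orbT.
  by case: eqVneq => //= w1; apply: (step u).
have KE : K = U.
  apply: ec => // u w uK wU euw; apply: (step u) => //.
  apply: contraNneq x0K => w1; have uU := subsetP KU' _ uK.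
  have : (u == x0) || (u == x2) by apply: suppress_nbr => //; rewrite es -w1.
  by case/orP => /eqP uE; [|apply: K20]; rewrite -uE.
by rewrite KE U1 in K1.
Qed.

End Suppress.
End Graph.

(** * Embeddings into the red graph of a colouring without blue books *)

Lemma exists_uncovered (T I : finType) (A : {set T}) (J : {set I}) (F : I -> {set T}) :
  \sum_(i in J) #|F i| < #|A| -> exists2 a, a \in A & forall i, i \in J -> a \notin F i.
Proof.
move=> lt; have [/existsP [a /andP[aA /forall_inP aF]]|ne] :=
  boolP [exists a, (a \in A) && [forall i in J, a \notin F i]]; first by exists a.
suff : #|A| <= \sum_(i in J) #|F i| by rewrite leqNgt lt.
apply: leq_card_cover_by => a aA.
have [/existsP [i /andP[iJ ai]]|naF] := boolP [exists i, (i \in J) && (a \in F i)]; first by exists i.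
case/negP: ne; apply/existsP; exists a; rewrite aA; apply/forall_inP => i iJ.
by apply: contra naF => ai; apply/existsP; exists i; rewrite iJ.
Qed.

Section Colouring.
Variables (T V : finType) (R : rel V) (e : rel T).
Hypotheses (Rs : symmetric R) (es : symmetric e) (ei : irreflexive e).
Implicit Types (A : {set V}) (U K L : {set T}) (f g : T -> V).

Definition blue : rel V := fun x y => (x != y) && ~~ R x y.

Definition no_book k :=
  forall x y, blue x y -> #|nbr blue setT x :&: nbr blue setT y| < k.

Definition near_red k A := forall x, x \in A -> #|nbr blue A x| < k.

Definition embeds U f A := [/\ {in U &, injective f}, forall x, x \in U -> f x \in A
  & forall x y, x \in U -> y \in U -> e x y -> R (f x) (f y)].

Lemma blue_sym : symmetric blue.
Proof. by move=> x y; rewrite /blue eq_sym Rs. Qed.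

Lemma near_redS k A A' : A' \subset A -> near_red k A -> near_red k A'.
Proof.
by move=> AA nA x xA; apply: leq_ltn_trans (nA x (subsetP AA _ xA)); rewrite subset_leq_card // nbrS.
Qed.

Lemma near_red_blue_nbr k A x : no_book k -> (forall y, y \in A -> blue x y) -> near_red k A.
Proof.
move=> nb xA y /xA xy; apply: leq_ltn_trans (nb _ _ xy); rewrite subset_leq_card //.
by apply/subsetP => z; rewrite !inE => /andP[/xA -> ->].
Qed.

Lemma embedsW U f A A' : A \subset A' -> embeds U f A -> embeds U f A'.
Proof. by move=> /subsetP AA [fi fA fR]; split=> // x /fA /AA. Qed.

Lemma embeds_sub U K f A : K \subset U -> embeds U f A -> embeds K f A.
Proof.
move=> /subsetP KU [fi fA fR]; split; first exact: sub_in2 fi.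
  by move=> x /KU /fA.
by move=> x y /KU xU /KU yU; apply: fR.
Qed.

Lemma embeds_extend U v f A w : embeds (U :\ v) f A -> w \in A -> w \notin f @: (U :\ v) ->
  (forall u, u \in nbr e U v -> R (f u) w) ->
  embeds U (fun u => if u == v then w else f u) A.
Proof.
move=> [fi fA fR] wA wf wR.
have inD x : x \in U -> x != v -> x \in U :\ v by rewrite !inE => -> ->.
have fw x : x \in U -> x != v -> f x != w.
  by move=> xU xv; apply: contraNneq wf => <-; apply/imset_f/inD.
have red x : x \in U -> e v x -> R (f x) w by move=> xU evx; apply: wR; rewrite inE xU.
split.
- move=> x y xU yU /=; case: eqVneq => [->|xv]; case: eqVneq => [->//|yv].
  + by move=> /eqP; rewrite eq_sym (negPf (fw _ yU yv)).
  + by move=> /eqP; rewrite (negPf (fw _ xU xv)).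
  + by move/(fi _ _ (inD _ xU xv) (inD _ yU yv)).
- by move=> x xU; case: eqVneq => // xv; apply/fA/inD.
- move=> x y xU yU /=; case: eqVneq => [->|xv]; case: eqVneq => [->|yv].
  + by rewrite ei.
  + by move=> exy; rewrite Rs; apply: red.
  + by rewrite es => exy; apply: red.
  + by apply: fR; apply: inD.
Qed.

Lemma embeds_greedy_step k U v f A : near_red k A -> embeds (U :\ v) f A ->
  #|U :\ v| + #|nbr e U v| * k.-1 < #|A| ->
  exists2 g, embeds U g A & forall u, u != v -> g u = f u.
Proof.
move=> nA fE lt; have [fi fA fR] := fE.
have nU u : u \in nbr e U v -> u \in U :\ v.
  by rewrite !inE => /andP[-> euv]; rewrite andbT; apply: contraTneq euv => ->; rewrite ei.
have [] := @exists_uncovered _ _ (A :\: f @: (U :\ v)) (nbr e U v) (fun u => nbr blue A (f u)).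
  apply: (@leq_ltn_trans (#|nbr e U v| * k.-1)).
    rewrite -sum_nat_const; apply: leq_sum => u /nU /fA /nA; lia.
  have c1 := cardsD A (f @: (U :\ v)); have c2 := subset_leq_card (subsetIr A (f @: (U :\ v))).
  have c3 : #|f @: (U :\ v)| <= #|U :\ v| := leq_imset_card f _.
  by lia.
move=> w; rewrite inE => /andP[wf wA] wB.
exists (fun u => if u == v then w else f u); last by move=> u /negPf ->.
apply: embeds_extend => // u un; have := wB u un; rewrite inE wA /= /blue.
rewrite negb_and !negbK => /orP[/eqP fu|//].
by rewrite -fu imset_f ?nU in wf.
Qed.

Lemma rooted_embeds_small k U A r a : near_red k A -> r \in U -> a \in A -> #|U| * k <= #|A| ->
  exists2 f, embeds U f A & f r = a.
Proof.
have [m] := ubnP #|U|; elim: m U => // m IH U Um nA rU aA le.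
have k0 : 0 < k by apply: leq_ltn_trans (nA _ aA).
have [Ur|[v]] := set_0Vmem (U :\ r).
  have U1 u : u \in U -> u = r.
    by move=> uU; apply: contraTeq isT => ur; have := in_set0 u; rewrite -Ur !inE ur uU.
  exists (fun=> a) => //; split=> //; first by move=> x y /U1 -> /U1 ->.
  by move=> x y /U1 -> /U1 ->; rewrite ei.
rewrite !inE => /andP[vr vU].
have Uv := cardsD1 v U; rewrite vU in Uv.
have rUv : r \in U :\ v by rewrite !inE eq_sym vr.
have [f fE fr] : exists2 f, embeds (U :\ v) f A & f r = a by apply: IH => //; nia.
have [|g gE gf] := embeds_greedy_step nA fE.
  have : #|nbr e U v| <= #|U :\ v|.
    apply: subset_leq_card; apply/subsetP => u; rewrite !inE => /andP[-> euv]; rewrite andbT.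
    by apply: contraTneq euv => ->; rewrite ei.
  nia.
by exists g; rewrite ?gf // eq_sym.
Qed.

Lemma rooted_embeds_sparse k q U A r a : near_red k A -> r \in U -> a \in A ->
  sparse q e U -> #|U| + 2 * k.-1 <= #|A| -> (2 * q + 3) * k <= #|A| ->
  exists2 f, embeds U f A & f r = a.
Proof.
have [m] := ubnP #|U|; elim: m U => // m IH U Um nA rU aA sU le leq.
have k0 : 0 < k by apply: leq_ltn_trans (nA _ aA).
have [/existsP [v /and3P[vU vr dv]]|big] :=
  boolP [exists v, [&& v \in U, v != r & #|nbr e U v| <= 2]].
  have Uv := cardsD1 v U; rewrite vU in Uv.
  have rUv : r \in U :\ v by rewrite !inE eq_sym vr.
  have [f fE fr] : exists2 f, embeds (U :\ v) f A & f r = a.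
    by apply: IH => //; try lia; apply: sparseS (subsetDl _ _) sU.
  have [|g gE gf] := embeds_greedy_step nA fE; first by nia.
  by exists g; rewrite ?gf // eq_sym.
apply: (rooted_embeds_small nA) => //.
suff : #|U| <= 2 * q + 3 by nia.
have := sU U (subxx _); rewrite /degsum (big_setD1 r) //=.
have : 3 * #|U :\ r| <= \sum_(u in U :\ r) #|nbr e U u|.
  rewrite mulnC -sum_nat_const; apply: leq_sum => u; rewrite !inE => /andP[ur uU].
  by rewrite ltnNge; apply: contra big => du; apply/existsP; exists u; rewrite uU ur du.
have := cardsD1 r U; rewrite rU; lia.
Qed.

(* Delete a vertex [v] of minimum degree.  If no free vertex is red to all the
   images of its neighbours, one of these images has blue degree at least [|U| k]. *)
Lemma embeds_linear k U (a0 : V) : no_book k -> 0 < k -> #|U| + degsum e U * k <= #|V| ->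
  exists f, embeds U f setT.
Proof.
move=> nb k0; have [m] := ubnP #|U|; elim: m U => // m IH U Um le.
have [->|[u0 u0U]] := set_0Vmem U; first by exists (fun=> a0); split=> [x|x|x]; rewrite inE.
case: (@arg_minnP _ u0 (fun u => u \in U) (fun u => #|nbr e U u|) u0U) => v vU vmin.
have dU : #|U| * #|nbr e U v| <= degsum e U.
  by rewrite -sum_nat_const; apply: leq_sum => u /vmin.
have Uv := cardsD1 v U; rewrite vU in Uv.
have le1 := degsum_le es ei (subsetDl U [set v]).
have [||f fE] := IH (U :\ v); [by lia|by nia|].
have [/existsP [u /andP[un uB]]|small] :=
    boolP [exists u, (u \in nbr e U v) && (#|U| * k <= #|nbr blue setT (f u)|)].
  have /set0Pn [a aB] : nbr blue setT (f u) != set0 by rewrite -card_gt0; nia.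
  have nA : near_red k (nbr blue setT (f u)).
    by apply: (near_red_blue_nbr (x := f u)) => // y; rewrite inE => /andP[].
  have [g gE _] := rooted_embeds_small nA vU aB uB.
  by exists g; apply: embedsW gE; apply: subsetT.
have [] := @exists_uncovered _ _ (~: (f @: (U :\ v))) (nbr e U v) (fun u => nbr blue setT (f u)).
  apply: (@leq_ltn_trans (#|nbr e U v| * (#|U| * k).-1)).
    rewrite -sum_nat_const; apply: leq_sum => u un.
    have : ~~ (#|U| * k <= #|nbr blue setT (f u)|).
      by apply: contra small => ?; apply/existsP; exists u; rewrite un.
    lia.
  have c1 := cardsC (f @: (U :\ v)).
  have c3 : #|f @: (U :\ v)| <= #|U :\ v| := leq_imset_card f _.
  nia.
move=> w; rewrite inE => wf wB.
exists (fun u => if u == v then w else f u).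
apply: embeds_extend => // u un; have := wB u un; rewrite inE in_setT /= /blue.
rewrite negb_and !negbK => /orP[/eqP fu|//].
rewrite -fu imset_f // in wf; move: un; rewrite !inE => /andP[-> euv]; rewrite andbT.
by apply: contraTneq euv => ->; rewrite ei.
Qed.

Lemma path_insert x s1 s2 y : path R x (s1 ++ s2) -> R (last x s1) y ->
  R y (head y s2) || nilp s2 -> path R x (s1 ++ y :: s2).
Proof.
rewrite !cat_path /= => /andP[-> ps] ->; case: s2 ps => //= b s2 /andP[_ ->].
by rewrite orbF => ->.
Qed.

Lemma path_insert_rev x s1 b s2 c s3 y : path R x (s1 ++ (b :: s2) ++ c :: s3) ->
  R (last x s1) y -> R y (last b s2) -> R b c ->
  path R x (s1 ++ y :: rev (b :: s2) ++ c :: s3).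
Proof.
rewrite cat_path => /andP[p1 p23] r1 r2 r3; rewrite cat_path p1 [path _ _ (_ :: _)]/= r1 andTb.
move: p23; rewrite cat_path /= => /and3P[/andP[_ p2] _ p3].
have lr : last y (rev (b :: s2)) = b by rewrite rev_cons last_rcons.
rewrite cat_path lr /= r3 p3 andbT lastI rev_rcons /= r2 rev_path.
by rewrite -(eq_path (e := R)) ?p2 // => u v; rewrite Rs.
Qed.

Lemma nth_cons_last_take (x : V) s i : i <= size s -> nth x (x :: s) i = last x (take i s).
Proof.
elim: i x s => [|i IH] x [|b s] //= le.
by rewrite -IH // (set_nth_default b).
Qed.

(* If [y] cannot be inserted, then [y] and the successors of its red neighbours
   on the path form a blue clique. *)
Lemma insert_many_red k x s y : no_book k -> path R x s -> uniq (x :: s) -> y \notin x :: s ->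
  k < #|[set i : 'I_(size s) | R y (nth x (x :: s) i)]| ->
  exists s', [/\ path R x s', last x s' = last x s & perm_eq s' (y :: s)].
Proof.
move=> nb pS uS yS; set I := [set i | _] => cI.
have nthd (i : 'I_(size s)) : drop i s = nth x s i :: drop i.+1 s by apply: drop_nth.
have [/existsP [i /andP[]]|no1] := boolP [exists i in I, R y (nth x s i)].
  rewrite inE nth_cons_last_take ?(ltnW (ltn_ord i)) // => r1 r2.
  exists (take i s ++ y :: drop i s); split.
  - by apply: path_insert; rewrite ?cat_take_drop //; [rewrite Rs | rewrite nthd /= r2].
  - by rewrite -[in RHS](cat_take_drop i s) nthd !last_cat.
  - by rewrite perm_catC /= perm_cons perm_catC cat_take_drop.
have [/existsP [i /andP[iI /existsP [j /and3P[jI ij r3]]]]|no2] :=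
    boolP [exists i in I, [exists j in I, (i < j) && R (nth x s i) (nth x s j)]].
  pose s2 := take (j - i.+1) (drop i.+1 s); pose s3 := drop j.+1 s.
  have s3E : drop j s = nth x s j :: s3 by rewrite nthd.
  have s2E : drop i s = (nth x s i :: s2) ++ nth x s j :: s3.
    by rewrite nthd -s3E /= -[in LHS](cat_take_drop (j - i.+1) (drop i.+1 s)) drop_drop subnK.
  have sE : s = take i s ++ (nth x s i :: s2) ++ nth x s j :: s3.
    by rewrite -s2E cat_take_drop.
  exists (take i s ++ y :: rev (nth x s i :: s2) ++ nth x s j :: s3); split.
  - apply: path_insert_rev => //; first by rewrite -sE.
      by move: iI; rewrite inE nth_cons_last_take ?(ltnW (ltn_ord i)) // Rs.
    move: jI; rewrite inE nth_cons_last_take ?(ltnW (ltn_ord j)) //.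
    suff -> : take j s = take i s ++ nth x s i :: s2 by rewrite last_cat.
    have : take j s ++ drop j s = (take i s ++ nth x s i :: s2) ++ drop j s.
      by rewrite cat_take_drop s3E -catA -sE.
    by move=> /(congr1 (fun t => rev t)); rewrite !rev_cat => /(congr1 (drop (size (rev (drop j s)))));
      rewrite !drop_size_cat // => /(congr1 rev); rewrite -rev_cat !revK.
  - by rewrite [in RHS]sE !last_cat /= !last_cat.
  - rewrite [in X in perm_eq _ X]sE perm_catC /= perm_cons perm_catC perm_cat2l.
    by rewrite -cat_cons perm_cat2r perm_rev.
have /set0Pn [i0 i0I] : I != set0 by rewrite -card_gt0; lia.
have inS (j : 'I_(size s)) : nth x s j \in s by apply: mem_nth.
have uS' : uniq s by case/andP: uS.
have by0 j : j \in I -> blue y (nth x s j).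
  move=> jI; rewrite /blue; apply/andP; split.
    by apply: contraNneq yS => ->; rewrite inE inS orbT.
  by apply: contra no1 => r; apply/existsP; exists j; rewrite jI.
have bij i j : i \in I -> j \in I -> i != j -> blue (nth x s i) (nth x s j).
  move=> iI jI ij; rewrite /blue nth_uniq // ij /=.
  apply: contra no2 => r; apply/existsP; have [lt|lt|eq] := ltngtP i j.
  - by exists i; rewrite iI; apply/existsP; exists j; rewrite jI lt.
  - by exists j; rewrite jI; apply/existsP; exists i; rewrite iI lt Rs.
  - by move: ij; rewrite -val_eqE /= eq eqxx.
have := nb _ _ (by0 _ i0I); rewrite ltnNge => /negP []; have := cardsD1 i0 I; rewrite i0I => cE.
apply: (@leq_trans #|[set nth x s j | j : 'I_(size s) in I :\ i0]|).
  rewrite card_in_imset; first by lia.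
  by move=> i j _ _ /eqP; rewrite nth_uniq // => /eqP /val_inj.
apply: subset_leq_card; apply/subsetP => z /imsetP [j]; rewrite in_setD1 => /andP[ji jI] ->.
by rewrite in_setI ![_ \in nbr _ _ _]inE !in_setT by0 //= bij // eq_sym.
Qed.

(* Neither [y1] nor [y2] has more than [k] red neighbours among the 3k first
   vertices of the path, so at least [k] of these are blue to both. *)
Lemma insert_blue_pair k x s y1 y2 : no_book k -> path R x s -> uniq (x :: s) ->
  3 * k <= size s -> y1 \notin x :: s -> y2 \notin x :: s -> blue y1 y2 ->
  exists y s', [/\ y \in [:: y1; y2], path R x s', last x s' = last x s & perm_eq s' (y :: s)].
Proof.
move=> nb pS uS sk n1 n2 b12.
pose I y := [set i : 'I_(size s) | R y (nth x (x :: s) i)].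
have [c1|c1] := ltnP k #|I y1|.
  by have [s' [? ? ?]] := insert_many_red nb pS uS n1 c1; exists y1, s'; rewrite mem_head.
have [c2|c2] := ltnP k #|I y2|.
  by have [s' [? ? ?]] := insert_many_red nb pS uS n2 c2; exists y2, s'; rewrite !inE eqxx orbT.
have := nb _ _ b12; rewrite ltnNge => /negP []; pose J := ~: (I y1 :|: I y2).
have cJ : k <= #|J|.
  have := cardsC (I y1 :|: I y2); rewrite card_ord -/J.
  have : #|I y1 :|: I y2| <= _ := leq_card_setU _ _; lia.
apply: leq_trans cJ _; rewrite -(@card_in_imset _ _ (fun i : 'I_(size s) => nth x (x :: s) i)).
  apply: subset_leq_card; apply/subsetP => z /imsetP [j]; rewrite !inE negb_or => /andP[j1 j2] ->.
  have jS : nth x (x :: s) j \in x :: s by apply: mem_nth; rewrite /= ltnS ltnW.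
  rewrite /blue j1 j2 !andbT; apply/andP; split.
    by apply: contraNneq n1 => ->.
  by apply: contraNneq n2 => ->.
move=> i j _ _ /eqP; rewrite nth_uniq //= ?ltnS ?(ltnW (ltn_ord _)) // => /eqP; exact: val_inj.
Qed.

End Colouring.

(** * Extending an embedding along a suspended path or at a leaf *)

Section Extensions.
Variables (T V : finType) (R : rel V) (e : rel T).
Hypotheses (Rs : symmetric R) (es : symmetric e) (ei : irreflexive e).
Implicit Types (A : {set V}) (U K L : {set T}) (f g : T -> V).

Lemma embeds_reroute U f x0 t z0 s :
  uniq (x0 :: t) -> path e x0 t -> {subset x0 :: t <= U} ->
  (forall u, u \in x0 :: t -> u != x0 -> u != last x0 t -> #|nbr e U u| = 2) ->
  uniq (z0 :: s) -> path R z0 s -> size s = size t ->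
  z0 = f x0 -> last z0 s = f (last x0 t) ->
  (forall u, u \in U -> u \notin x0 :: t -> f u \notin z0 :: s) ->
  {in U :\: [set u in x0 :: t] &, injective f} ->
  (forall u w, u \in U -> w \in U -> e u w ->
     [|| u \notin x0 :: t, u == x0 | u == last x0 t] ->
     [|| w \notin x0 :: t, w == x0 | w == last x0 t] -> R (f u) (f w)) ->
  embeds R e U (fun u => if u \in x0 :: t then nth z0 (z0 :: s) (index u (x0 :: t)) else f u) setT.
Proof.
move=> uP pe PU d2 uZ pR sz fx0 flast fZ finj fR.
set P := x0 :: t in uP PU d2 fZ finj fR *; set Z := z0 :: s in uZ fZ *.
have szPZ : size Z = size P by rewrite /= sz.
have iZ u : u \in P -> index u P < size Z by rewrite szPZ index_mem.
set g := fun u => _.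
have gends u : [|| u \notin P, u == x0 | u == last x0 t] -> g u = f u.
  case/or3P => [/negPf uN|/eqP ->|/eqP ->]; rewrite /g.
  - by rewrite uN.
  - by rewrite mem_head /= eqxx.
  - rewrite mem_last index_last // -sz.
    by rewrite -flast -[RHS]/(last z0 (z0 :: s)) -nth_last.
split=> //.
- move=> u w uU wU; rewrite /g; have [uP'|uP'] := boolP (u \in P); have [wP|wP] := boolP (w \in P).
  + by move/eqP; rewrite nth_uniq ?iZ // => /eqP /(congr1 (nth x0 P)); rewrite !nth_index.
  + by move=> fw; have := fZ _ wU wP; rewrite -fw mem_nth ?iZ.
  + by move=> fw; have := fZ _ uU uP'; rewrite fw mem_nth ?iZ.
  + by apply: finj; rewrite !inE ?uP' ?wP.
have inner u w : u \in P -> u != x0 -> u != last x0 t -> w \in U -> e u w -> R (g u) (g w).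
  move=> uP' u0 ul wU euw.
  pose i := (index u t).
  have ut : u \in t by move: uP'; rewrite inE (negPf u0).
  have it : i < size t by rewrite index_mem.
  have it1 : i.+1 < size t.
    rewrite ltn_neqAle it andbT; apply: contra ul => /eqP iE.
    by rewrite -[u](nth_index x0 ut) -/i -nth_last -iE /=.
  have uE : u = nth x0 t i by rewrite nth_index.
  have /pathP pe' := pe; have /pathP pR' := pR.
  have e1 := pe' x0 i it; have e2 := pe' x0 i.+1 it1.
  have i0 : i < size P by apply: ltnW.
  have i1 : i.+1 < size P by [].
  have i2 : i.+2 < size P by [].
  have n1 : nth x0 P i != nth x0 P i.+2.
    by rewrite (nth_uniq x0 i0 i2 uP) neq_ltn ltnS leqnSn.
  have inP j : j < size P -> nth x0 P j \in U by move=> jP; apply: PU; apply: mem_nth.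
  have gE j : j < size P -> g (nth x0 P j) = nth z0 Z j.
    by move=> jP; rewrite /g mem_nth // index_uniq.
  have : (w == nth x0 P i) || (w == nth x0 P i.+2).
    apply: contraT; rewrite negb_or => /andP[w1 w2].
    have : 3 <= #|nbr e U u|.
      apply: (@card_nbr_ge3 _ _ _ _ (nth x0 P i) (nth x0 P i.+2) w) => //.
      - by rewrite /= !inE negb_or n1 eq_sym w1 eq_sym w2.
      - exact: inP.
      - exact: inP.
      - by rewrite uE es.
      - by rewrite uE.
    by rewrite d2.
  have -> : u = nth x0 P i.+1 by [].
  case/orP => /eqP ->.
    by rewrite !gE // Rs; apply: pR'; rewrite sz.
  by rewrite !gE //; apply: (pR' z0 i.+1); rewrite sz.
move=> u w uU wU euw.
have [uE|] := boolP [|| u \notin P, u == x0 | u == last x0 t]; last first.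
  by rewrite 2!negb_or negbK => /and3P[uP' u0 ul]; apply: inner.
have [wE|] := boolP [|| w \notin P, w == x0 | w == last x0 t]; last first.
  by rewrite 2!negb_or negbK => /and3P[wP w0 wl]; rewrite Rs; apply: inner; rewrite // es.
by rewrite !gends //; apply: fR.
Qed.

Lemma embeds_unsuppress k U f x0 x1 x2 t : no_book R k ->
  path e x0 [:: x1, x2 & t] -> uniq [:: x0, x1, x2 & t] ->
  {subset [:: x0, x1, x2 & t] <= deg2 e U} -> 3 * k <= size (x2 :: t) ->
  embeds R (suppress e x0 x2) (U :\ x1) f setT ->
  #|U| <= #|~: (f @: (U :\ x1))| ->
  exists g, embeds R e U g setT.
Proof.
move=> nb pe uP PD sk [finj _ fR]; set Y := ~: _ => cY.
have PU : {subset [:: x0, x1, x2 & t] <= U} by move=> u /PD; rewrite inE => /andP[].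
have [/existsP [y1 /existsP [y2 /and3P[y1Y y2Y b12]]]|red] :=
    boolP [exists y1, exists y2, [&& y1 \in Y, y2 \in Y & blue R y1 y2]]; last first.
  have nY : near_red R 1 Y.
    move=> y1 y1Y; rewrite ltnS leqn0 cards_eq0; apply/eqP/setP => y2; rewrite in_set0 [_ \in nbr _ _ _]inE.
    apply: contraNF red => /andP[y2Y b12]; apply/existsP; exists y1; apply/existsP; exists y2.
    by rewrite y1Y y2Y b12.
  have x0U : x0 \in U by apply: PU; rewrite mem_head.
  have /set0Pn [a aY] : Y != set0.
    rewrite -card_gt0; apply: leq_trans cY; rewrite card_gt0; apply/set0Pn; by exists x0.
  have [g gE _] := rooted_embeds_small Rs es ei nY x0U aY (etrans (congr1 (leq^~ _) (muln1 _)) cY).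
  by exists g; apply: embedsW gE; apply: subsetT.
have nx1 : x1 \notin [:: x0, x2 & t].
  case/and3P: uP => n0 n1 _; rewrite inE negb_or n1 andbT eq_sym.
  by move: n0; rewrite inE negb_or => /andP[].
have inU1 u : u \in [:: x0, x2 & t] -> u \in U :\ x1.
  move=> uP'; rewrite in_setD1 PU ?andbT; last first.
    by move: uP'; rewrite !inE => /or3P[] ->; rewrite ?orbT.
  by apply: contraNneq nx1 => <-.
have uP' : uniq [:: x0, x2 & t].
  by move: uP => /= /and3P[]; rewrite inE negb_or => /andP[_ ->] _ ->.
have fP : uniq (f x0 :: map f (x2 :: t)).
  by rewrite -map_cons map_inj_in_uniq // => u w /inU1 uU /inU1 wU; apply: finj.
have e22 : path e x2 t by case/and3P: pe.
have pR : path R (f x0) (map f (x2 :: t)).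
  rewrite /= fR ?inU1 ?mem_head ?inE ?eqxx ?orbT //= /suppress ?eqxx ?orbT //.
  rewrite path_map; apply: (@sub_in_path _ (mem (U :\ x1)) e) e22.
    by move=> u w uU wU euw /=; apply: fR => //; rewrite /suppress euw.
  by apply/allP => u ut; apply: inU1; rewrite inE ut orbT.
have nY y : y \in Y -> y \notin f x0 :: map f (x2 :: t).
  rewrite inE; apply: contra; rewrite -map_cons => /mapP [u /inU1 uU ->]; exact: imset_f.
have sk' : 3 * k <= size (map f (x2 :: t)) by rewrite size_map.
have [y [s [yy pRs ls ps]]] := insert_blue_pair Rs nb pR fP sk' (nY _ y1Y) (nY _ y2Y) b12.
have yY : y \in Y by move: yy; rewrite in_cons mem_seq1 => /orP[] /eqP ->.
have psZ : perm_eq (f x0 :: s) (y :: f x0 :: map f (x2 :: t)).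
  apply: (perm_trans (y := f x0 :: y :: map f (x2 :: t))); first by rewrite perm_cons.
  exact/permPl/(perm_catCA [:: f x0] [:: y]).
eexists; apply: (@embeds_reroute U f x0 [:: x1, x2 & t] (f x0) s) => //.
- by move=> u /PD; rewrite inE => /andP[_ /eqP].
- by rewrite (perm_uniq psZ) /= (nY _ yY).
- by rewrite (perm_size ps) /= size_map.
- by rewrite ls /= last_map.
- move=> u uU; apply: contra; rewrite (perm_mem psZ) inE -map_cons => /orP[/eqP uy|].
    have u1 : u = x1.
      apply: contraTeq yY => u1; rewrite inE negbK -uy imset_f // !inE u1; exact: uU.
    by rewrite u1 !inE eqxx orbT.
  move=> /mapP [w wP fuw]; have [->|u1] := eqVneq u x1; first by rewrite !inE eqxx orbT.
  have uw : u = w by apply: finj => //; [rewrite in_setD1 u1 | apply: inU1].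
  by move: wP; rewrite uw !inE => /or3P[] ->; rewrite ?orbT.
- move=> u w; rewrite !inE !negb_or => /andP[/and4P[_ u1 _ _] uU] /andP[/and4P[_ w1 _ _] wU].
  by apply: finj; rewrite !inE ?u1 ?w1.
move=> u w uU wU euw uE wE.
have l1 : last x0 [:: x1, x2 & t] != x1.
  by apply: contraNneq nx1 => <-; rewrite /= inE mem_last orbT.
have n1 v : [|| v \notin [:: x0, x1, x2 & t], v == x0 | v == last x0 [:: x1, x2 & t]] -> v != x1.
  case/or3P => [|/eqP ->|/eqP -> //]; first by rewrite !inE !negb_or => /and4P[].
  by apply: contraNneq nx1 => <-; rewrite mem_head.
apply: fR; rewrite ?inE ?n1 //; by rewrite /suppress euw.
Qed.

(* In the second case the outside vertices are all blue to the image of the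
   neighbour of [l]. *)
Lemma leaf_alternative k U l f : no_book R k -> l \in leaves e U ->
  embeds R e (U :\ l) f setT ->
  (exists g, embeds R e U g setT) \/ near_red R k (~: (f @: (U :\ l))).
Proof.
rewrite inE => nb /andP[lU /cards1P [p pE]] fE.
have pU : p \in U :\ l.
  have : p \in nbr e U l by rewrite pE set11.
  rewrite !inE => /andP[-> elp]; rewrite andbT.
  by apply: contraTneq elp => ->; rewrite ei.
have [/existsP [w /andP[wf rw]]|nw] := boolP [exists w, (w \notin f @: (U :\ l)) && R (f p) w].
  left; eexists; apply: (embeds_extend Rs es ei fE (w := w)) => //.
  by move=> u; rewrite pE inE => /eqP ->.
right; apply: (@near_red_blue_nbr _ _ _ _ (f p)) => // y; rewrite inE => yf.
rewrite /blue; apply/andP; split; first by apply: contraNneq yf => <-; apply: imset_f.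
by apply: contra nw => r; apply/existsP; exists y; rewrite yf.
Qed.

(* The centre goes to a vertex [a] of [A] with at least as many red neighbours
   outside [A] as blue neighbours inside; if there is none, any blue edge inside
   [A] has many common blue neighbours outside. *)
Lemma embeds_star k q A U L x : no_book R k -> near_red R k A -> 3 * k <= #|~: A| -> #|U| <= #|A| ->
  sparse q e U -> (2 * q + 3) * k <= #|A| -> x \in U -> L \subset U ->
  (forall l, l \in L -> nbr e U l = [set x]) -> 2 * k.-1 <= #|L| ->
  exists g, embeds R e U g setT.
Proof.
move=> nb nA cA UA sU qA xU LU Lx Lk.
have U0 : 0 < #|U| by rewrite card_gt0; apply/set0Pn; exists x.
have /set0Pn [a0 a0A] : A != set0 by rewrite -card_gt0; lia.
pose out a := [set z in ~: A | R a z].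
have [/existsP [a /andP[aA aout]]|none] :=
    boolP [exists a, (a \in A) && (#|nbr (blue R) A a| <= #|out a|)]; last first.
  have many a : a \in A -> #|out a| < #|nbr (blue R) A a|.
    by move=> aA; rewrite ltnNge; apply: contra none => ?; apply/existsP; exists a; rewrite aA.
  have /set0Pn [b] : nbr (blue R) A a0 != set0.
    by rewrite -card_gt0; apply: leq_ltn_trans (many _ a0A).
  rewrite inE => /andP[bA ab].
  have := nb _ _ ab; rewrite ltnNge => /negP [].
  apply: (@leq_trans #|~: A :\: (out a0 :|: out b)|).
    have c1 := cardsD (~: A) (out a0 :|: out b).
    have c2 := subset_leq_card (subsetIr (~: A) (out a0 :|: out b)).
    have c3 : #|out a0 :|: out b| <= _ := leq_card_setU _ _.
    have := many _ a0A; have := many _ bA; have := nA _ a0A; have := nA _ bA; lia.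
  apply: subset_leq_card; apply/subsetP => z; rewrite !inE /blue => /andP[+ zA].
  rewrite zA /= negb_or => /andP[-> ->]; rewrite !andbT.
  by apply/andP; split; apply: contraNneq zA => <-.
have xL : x \notin L.
  apply/negP => xL; have := Lx _ xL => /setP /(_ x); by rewrite !inE ei eqxx andbF.
have cUL : #|U :\: L| = #|U| - #|L| by rewrite cardsD (setIidPr LU).
have LUc := subset_leq_card LU.
have xUL : x \in U :\: L by rewrite inE xL.
have [|f fE fx] := rooted_embeds_sparse Rs es ei nA xUL aA (sparseS (subsetDl _ _) sU) _ qA.
  by lia.
have [finj fA fR] := fE.
pose C := (A :\: f @: (U :\: L)) :\: nbr (blue R) A a :|: out a.
have cC : #|L| <= #|C|.
  rewrite cardsU.
  have -> : ((A :\: f @: (U :\: L)) :\: nbr (blue R) A a) :&: out a = set0.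
    by apply/setP => z; rewrite !inE; case: (z \in A); rewrite ?andbF.
  have c1 := cardsD A (f @: (U :\: L)); have c2 := subset_leq_card (subsetIr A (f @: (U :\: L))).
  have c3 : #|f @: (U :\: L)| <= #|U :\: L| := leq_imset_card f _.
  have c4 := cardsD (A :\: f @: (U :\: L)) (nbr (blue R) A a).
  have c5 := subset_leq_card (subsetIr (A :\: f @: (U :\: L)) (nbr (blue R) A a)).
  rewrite cards0; lia.
have CR z : z \in C -> R a z.
  rewrite !inE => /orP[/and3P[nb' zf zA]|/andP[]//]; move: nb'; rewrite zA /= /blue.
  rewrite negb_and !negbK => /orP[/eqP za|//]; by rewrite -za -fx imset_f in zf.
have Cf u z : z \in C -> u \in U :\: L -> f u != z.
  move=> + uU; rewrite inE => /orP[|].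
    by rewrite !inE => /and3P[_ zf _]; apply: contraNneq zf => <-; rewrite imset_f.
  by rewrite !inE => /andP[zA _]; apply: contraNneq zA => <-; apply: fA.
pose h u := nth a (enum C) (index u (enum L)).
have hlt u : u \in L -> index u (enum L) < size (enum C).
  by move=> uL; rewrite -cardE; apply: leq_trans cC; rewrite cardE index_mem mem_enum.
have hC u : u \in L -> h u \in C by move=> uL; rewrite -mem_enum mem_nth ?hlt.
have hinj : {in L &, injective h}.
  move=> u w uL wL /eqP; rewrite nth_uniq ?enum_uniq ?hlt // => /eqP.
  by move/(congr1 (nth x (enum L))); rewrite !nth_index ?mem_enum.
exists (fun u => if u \in L then h u else f u); split=> //.
- move=> u w uU wU /=; have [uL|uL] := boolP (u \in L); have [wL|wL] := boolP (w \in L).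
  + exact: hinj.
  + by move/eqP; rewrite eq_sym (negPf (Cf _ _ (hC _ uL) _)) // inE wL.
  + by move/eqP; rewrite (negPf (Cf _ _ (hC _ wL) _)) // inE uL.
  + by apply: finj; rewrite inE ?uL ?wL.
have leafR u w : u \in L -> w \in U -> e u w -> w \notin L /\ R (h u) (f w).
  move=> uL wU euw; have : w \in nbr e U u by rewrite inE wU.
  by rewrite (Lx _ uL) inE => /eqP ->; rewrite xL fx Rs CR ?hC.
move=> u w uU wU euw; have [uL|uL] := boolP (u \in L).
  by have [/negPf -> ?] := leafR _ _ uL wU euw.
have [wL|wL] := boolP (w \in L).
  by have [|_ ?] := leafR _ _ wL uU; [rewrite es | rewrite Rs].
by apply: fR; rewrite ?inE ?uL ?wL.
Qed.

(* If the free vertex [r] is blue to the image of [par l], move some leaf [v] of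
   [P] to [r] and put [l] at the former image of [v]. *)
Lemma embeds_leaf_swap k c A U (P : {set T}) l f (par : T -> T) : near_red R k A -> #|U| <= #|A| ->
  embeds R e (U :\ l) f A -> l \in U -> nbr e U l = [set par l] ->
  P \subset U :\ l -> (forall v, v \in P -> nbr e U v = [set par v]) ->
  (forall v, v \in P -> par v != l) -> par l \notin P ->
  (forall x, #|[set v in P | par v == x]| <= c) -> (k - 2) + k.-1 * c < #|P| ->
  exists g, embeds R e U g A.
Proof.
move=> nA UA fE lU lpar PU Ppar Pl lP cP lt; have [finj fA fR] := fE.
have Ul := cardsD1 l U; rewrite lU in Ul.
have parU v : nbr e U v = [set par v] -> (par v \in U) && e v (par v).
  by move=> /setP /(_ (par v)); rewrite !inE eqxx.
have parn v : nbr e U v = [set par v] -> par v != v.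
  by move=> /parU /andP[_]; apply: contraTneq => ->; rewrite ei.
have plU : par l \in U :\ l by rewrite !inE parn //; case/andP: (parU _ lpar).
have /set0Pn [r] : A :\: f @: (U :\ l) != set0.
  rewrite -card_gt0.
  have c1 := cardsD A (f @: (U :\ l)); have c2 := subset_leq_card (subsetIr A (f @: (U :\ l))).
  have c3 : #|f @: (U :\ l)| <= #|U :\ l| := leq_imset_card f _.
  lia.
rewrite inE => /andP[rf rA].
have frn u : u \in U :\ l -> f u != r.
  by move=> uU; apply: contraNneq rf => <-; apply: imset_f.
have [rr|br] := boolP (R (f (par l)) r).
  eexists; apply: (embeds_extend Rs es ei fE rA rf) => u.
  by rewrite lpar inE => /eqP ->.
have blr : blue R (f (par l)) r by rewrite /blue frn.
have PUl v : v \in P -> v \in U :\ l by apply: (subsetP PU).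
pose bad1 := [set v in P | blue R (f (par l)) (f v)].
pose bad2 := [set v in P | blue R r (f (par v))].
have b1 : #|bad1| <= k - 2.
  have := cardsD1 r (nbr (blue R) A (f (par l))); rewrite inE rA blr /=.
  have := nA _ (fA _ plU).
  suff : #|bad1| <= #|nbr (blue R) A (f (par l)) :\ r| by lia.
  rewrite -(card_in_imset (f := f) (D := bad1)).
    apply: subset_leq_card; apply/subsetP => z /imsetP [v]; rewrite inE => /andP[vP bv] ->.
    by rewrite !inE frn ?PUl // fA ?PUl.
  move=> u w; rewrite !inE => /andP[uP _] /andP[wP _]; by apply: finj; apply: PUl.
have parUl v : v \in P -> par v \in U :\ l.
  by move=> vP; have /andP[pU _] := parU _ (Ppar _ vP); rewrite !inE Pl.
have b2 : #|bad2| <= k.-1 * c.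
  apply: (@leq_trans (#|nbr (blue R) A r| * c)); last by have := nA _ rA; nia.
  rewrite -sum_nat_const.
  apply: (@leq_trans (\sum_(z in nbr (blue R) A r) #|[set v in P | f (par v) == z]|)).
    apply: leq_card_cover_by => v; rewrite inE => /andP[vP bv].
    by exists (f (par v)); rewrite inE ?vP ?eqxx // fA ?parUl.
  apply: leq_sum => z _.
  have [->|[v0]] := set_0Vmem [set v in P | f (par v) == z]; first by rewrite cards0.
  rewrite inE => /andP[v0P /eqP v0z]; apply: leq_trans (cP (par v0)).
  apply: subset_leq_card; apply/subsetP => v; rewrite !inE -v0z => /andP[vP /eqP fv].
  by rewrite vP; apply/eqP/finj => //; apply: parUl.
have /set0Pn [v] : P :\: (bad1 :|: bad2) != set0.
  rewrite -card_gt0.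
  have c1 := cardsD P (bad1 :|: bad2); have c2 := subset_leq_card (subsetIr P (bad1 :|: bad2)).
  have c3 : #|bad1 :|: bad2| <= _ := leq_card_setU _ _.
  lia.
rewrite inE => /andP[vbad vP]; move: vbad; rewrite !inE vP /= negb_or => /andP[nb1 nb2].
have vU := PUl _ vP; have pvU := parUl _ vP.
have R1 : R (f (par l)) (f v).
  move: nb1; rewrite /blue negb_and !negbK => /orP[/eqP|//] /(finj _ _ plU vU) pv.
  by rewrite pv vP in lP.
have R2 : R r (f (par v)).
  by move: nb2; rewrite /blue negb_and !negbK => /orP[/eqP rE|//]; have := frn _ pvU; rewrite -rE eqxx.
have fE' : embeds R e ((U :\ l) :\ v) f A by apply: embeds_sub fE; apply: subsetDl.
have gE : embeds R e (U :\ l) (fun u => if u == v then r else f u) A.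
  apply: (embeds_extend Rs es ei fE' rA).
    by apply: contra rf => /imsetP [u uU ->]; apply: imset_f; move: uU; rewrite inE => /andP[].
  move=> u; rewrite inE => /andP[uU evu]; suff -> : u = par v by rewrite Rs.
  apply/set1P; rewrite -Ppar // inE evu andbT; by move: uU; rewrite inE => /andP[].
eexists; apply: (embeds_extend Rs es ei gE (fA _ vU)).
  apply/negP => /imsetP [u uU]; case: eqVneq => [_ fr|uv].
    by have := frn _ vU; rewrite fr eqxx.
  by move/(finj _ _ vU uU) => vu; rewrite vu eqxx in uv.
move=> u; rewrite lpar inE => /eqP ->.
by case: eqVneq => // plv; rewrite plv vP in lP.
Qed.

Lemma leaf_parent U : cut_connected e U -> 2 < #|U| -> exists par : T -> T,
  forall l, l \in leaves e U -> nbr e U l = [set par l] /\ par l \notin leaves e U.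
Proof.
move=> ec U2; exists (fun l => odflt l [pick w in nbr e U l]) => l lL.
move: (lL); rewrite inE => /andP[lU /cards1P [p pE]].
have -> : odflt l [pick w in nbr e U l] = p.
  rewrite pE; case: pickP => [w|/(_ p)]; rewrite inE ?eqxx //; by move/eqP.
split=> //; apply/negP; rewrite inE => /andP[pU /cards1P [m mE]].
have elp : e l p by have /setP /(_ p) := pE; rewrite !inE eqxx => /andP[].
have ml : m = l.
  by have /setP /(_ l) := mE; rewrite !inE lU es elp => /esym /eqP.
suff KU : [set l; p] = U by move: U2; rewrite -KU cards2; case: eqP.
apply: ec; first by rewrite subUset !sub1set lU pU.
  by apply/set0Pn; exists l; rewrite set21.
move=> u w; rewrite !inE => /orP[] /eqP -> wU ew.
  by have /setP /(_ w) := pE; rewrite !inE wU ew => /esym ->; rewrite orbT.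
by have /setP /(_ w) := mE; rewrite !inE wU ew ml => /esym ->.
Qed.

Lemma embeds_near_red k q A U : 0 < k -> no_book R k -> near_red R k A -> 3 * k <= #|~: A| ->
  #|U| <= #|A| -> 2 < #|U| -> cut_connected e U ->
  sparse q e U -> (2 * q + 3) * k <= #|A| ->
  (#|U| + 2 * k.-1 <= #|A|) || (2 * k * k.-1 <= #|leaves e U|) ->
  exists g, embeds R e U g setT.
Proof.
move=> k0 nb nA cA UA U2 ec sU qA.
have /set0Pn [u0 u0U] : U != set0 by rewrite -card_gt0; lia.
have /set0Pn [a aA] : A != set0 by rewrite -card_gt0; lia.
case/orP => [small|manyL].
  have [g gE _] := rooted_embeds_sparse Rs es ei nA u0U aA sU small qA.
  by exists g; apply: embedsW gE; apply: subsetT.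
have [par parP] := leaf_parent ec U2; set L0 := leaves e U in parP manyL *.
have L0U : L0 \subset U by apply/subsetP => u; rewrite inE => /andP[].
have [/existsP [x /andP[xU cx]]|few] :=
    boolP [exists x, (x \in U) && (2 * k.-1 <= #|[set l in L0 | par l == x]|)].
  apply: (@embeds_star k q A U [set l in L0 | par l == x] x) => //.
    by apply/subsetP => l; rewrite inE => /andP[lL _]; apply: (subsetP L0U).
  by move=> l; rewrite inE => /andP[lL /eqP <-]; case: (parP _ lL).
have few' x : #|[set l in L0 | par l == x]| <= 2 * k.-1 - 1.
  have [->|[l]] := set_0Vmem [set l in L0 | par l == x]; first by rewrite cards0.
  rewrite inE => /andP[lL /eqP px].
  have xU : x \in U by have [/setP /(_ x)] := parP _ lL; rewrite px !inE eqxx => /andP[].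
  suff : #|[set l in L0 | par l == x]| < 2 * k.-1 by lia.
  by rewrite ltnNge; apply: contra few => ?; apply/existsP; exists x; rewrite xU.
have k2 : 1 < k.
  by rewrite ltnNge; apply: contra few => k1; apply/existsP; exists u0; rewrite u0U; lia.
suff main j L : j = 2 * k.-1 - #|L| -> L \subset L0 -> #|L| <= 2 * k.-1 ->
    exists g, embeds R e (U :\: L) g A.
  have [|g] := main _ set0 erefl (sub0set _); first by rewrite cards0.
  by rewrite setD0 => gE; exists g; apply: embedsW gE; apply: subsetT.
elim: j L => [|j IH] L jE LL Lk.
  have LU := subset_trans LL L0U.
  have cUL : #|U :\: L| = #|U| - #|L| by rewrite cardsD (setIidPr LU).
  have /set0Pn [l lL] : L0 != set0 by rewrite -card_gt0; nia.
  have [plE pl] := parP _ lL.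
  have rU : par l \in U :\: L.
    rewrite inE (contra (subsetP LL _)) //.
    by have /setP /(_ (par l)) := plE; rewrite !inE eqxx => /andP[].
  have [|g gE _] := rooted_embeds_sparse Rs es ei nA rU aA (sparseS (subsetDl _ _) sU) _ qA.
    by have := subset_leq_card LU; lia.
  by exists g.
have cL := cardsD L0 L; rewrite (setIidPr LL) in cL.
have /set0Pn [l] : L0 :\: L != set0 by rewrite -card_gt0; nia.
rewrite inE => /andP[lL lL0].
have cl : #|l |: L| = #|L|.+1 by rewrite cardsU1 lL.
have LL' : l |: L \subset L0 by rewrite subUset sub1set lL0.
have [||f fE] := IH (l |: L) _ LL'; [lia|lia|].
have UE : U :\: (l |: L) = (U :\: L) :\ l by rewrite setUC setDDl.
have parL v : v \in L0 -> v \notin L -> nbr e (U :\: L) v = [set par v].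
  move=> vL vnL; have [pE pL] := parP _ vL.
  apply/setP => w; rewrite -pE !inE; case: (boolP (w \in L)) => //= wL.
  apply/esym; apply: contraNF pL => /andP[wU ew].
  have <- : w = par v by apply/set1P; rewrite -pE inE wU.
  exact: (subsetP LL).
rewrite UE in fE.
apply: (@embeds_leaf_swap k (2 * k.-1 - 1) A (U :\: L) (L0 :\: (l |: L)) l f par) => //.
- by apply: leq_trans UA; rewrite subset_leq_card ?subsetDl.
- by rewrite inE lL (subsetP L0U).
- exact: parL.
- by rewrite -UE; apply: setSD.
- by move=> v; rewrite in_setD in_setU negb_or => /andP[/andP[_ vL] vL0]; apply: parL.
- move=> v; rewrite in_setD => /andP[_ vL0]; have [_ pv] := parP _ vL0.
  by apply: contraNneq pv => ->.
- have [_ pl] := parP _ lL0; by rewrite in_setD (negPf pl) andbF.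
- move=> x; apply: leq_trans (few' x); apply: subset_leq_card; apply/subsetP => v.
  by rewrite inE in_setD => /andP[/andP[_ vL0] px]; rewrite inE vL0.
have := cardsD L0 (l |: L); rewrite (setIidPr LL') cl.
nia.
Qed.

End Extensions.

(** * The induction *)

Section Main.
Variables (T V : finType) (R : rel V) (k n q : nat).
Hypotheses (Rs : symmetric R) (nb : no_book R k) (k_gt0 : 0 < k)
  (cardV : #|V| = 2 * n - 1) (n_ge : 34 * k ^ 3 <= n)
  (q_le : q * (119 * k ^ 2 + 62 * k) <= n).

Lemma q_bounds : [/\ q * (36 * (k * k) + 38 * k + 9) <= n, 6 * (q * (18 * k + 9)) <= n,
  (2 * q + 3) * k <= n & 24 * (k * (k * k)) + n %/ 6 < n].
Proof.
have kk : k <= k * k by rewrite leq_pmull.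
have kkk : k * k <= k * (k * k) by rewrite leq_pmull.
have n34 : 34 * (k * (k * k)) <= n by move: n_ge; rewrite !expnS expn0 muln1.
have qk : q * (119 * (k * k) + 62 * k) <= n by move: q_le; rewrite !expnS expn0 muln1.
split.
- by apply: leq_trans qk; rewrite leq_mul2l; apply/orP; right; lia.
- rewrite mulnCA; apply: leq_trans qk; rewrite leq_mul2l; apply/orP; right; lia.
- suff : q * k * 12 <= n by lia.
  apply: leq_trans qk; rewrite -mulnA leq_mul2l; apply/orP; right; lia.
- lia.
Qed.

Lemma many_leaves m L : 2 * n - 1 < m + 2 * (m + q) * k -> m <= n ->
  m <= (6 * k + 3) * (2 * L + 3 * q) ->
  0 < L /\ ((m + 2 * k.-1 <= n) || (2 * k * k.-1 <= L)).
Proof.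
have [qn1 qn2 _ n24] := q_bounds => big mn mL; split.
  rewrite lt0n; apply/eqP => L0; move: mL; rewrite L0 muln0 add0n => mL.
  have : m * (2 * k + 1) <= (6 * k + 3) * (3 * q) * (2 * k + 1) by rewrite leq_mul2r mL orbT.
  nia.
have [//|mbig] := leqP (m + 2 * k.-1) n; rewrite /= leqNgt; apply/negP => Lsmall.
have : (6 * k + 3) * (2 * L + 3 * q) <= (6 * k + 3) * (2 * (2 * k * k.-1 - 1) + 3 * q).
  by rewrite leq_mul2l; lia.
case: (k) k_gt0 qn2 n24 mbig Lsmall mL => // j _ /=.
have : n %/ 6 * 6 <= n by apply: leq_divM.
nia.
Qed.

Lemma near_red_subset (A : {set V}) : n <= #|A| -> exists A' : {set V}, A' \subset A /\ #|A'| = n.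
Proof.
move=> nA; exists [set x in take n (enum A)]; split.
  by apply/subsetP => x; rewrite inE => /mem_take; rewrite mem_enum.
have /card_uniqP uA : uniq (take n (enum A)) by rewrite take_uniq ?enum_uniq.
by rewrite cardsE uA size_takel // -cardE.
Qed.

Lemma sparse_connected_embeds (e : rel T) (U : {set T}) : symmetric e -> irreflexive e ->
  cut_connected e U -> degsum e U <= 2 * (#|U| + q) -> #|U| <= n ->
  exists f, embeds R e U f setT.
Proof.
have [qn1 qn2 qn3 n24] := q_bounds.
have n34 : 34 * k <= n by move: n24; nia.
have [m] := ubnP #|U|; elim: m e U => // m IH e U Um es ei ec eU Un.
have [a0 _] : exists a : V, true.
  have /card_gt0P [a _] : 0 < #|V| by rewrite cardV; move: n34 k_gt0; clear; lia.
  by exists a.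
have [small|big] := leqP (#|U| + degsum e U * k) #|V|.
  exact: (embeds_linear Rs es ei a0 nb k_gt0 small).
have big' : 2 * n - 1 < #|U| + 2 * (#|U| + q) * k.
  by rewrite -cardV; apply: leq_trans big _; rewrite leq_add2l leq_mul2r eU orbT.
have Ubig : 3 * k + 2 < #|U|.
  rewrite ltnNge; apply/negP => Usmall.
  have : k * k <= k * (k * k) by rewrite leq_pmull.
  have : k <= k * k by rewrite leq_pmull.
  have : #|U| * (2 * k + 1) <= (3 * k + 2) * (2 * k + 1) by rewrite leq_mul2r Usmall orbT.
  lia.
have outside (f : T -> V) v : v \in U -> n <= #|~: (f @: (U :\ v))|.
  move=> vU; have c1 := cardsC (f @: (U :\ v)); have c2 := cardsD1 v U; rewrite vU in c2.
  have c3 : #|f @: (U :\ v)| <= #|U :\ v| := leq_imset_card f _.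
  by move: c1 c2 c3 cardV Un; clear; lia.
have [/existsP [y /existsP [p /and3P[pe up /allP pD]]]|noP] :=
    boolP [exists y, exists p : (3 * k + 1).-tuple T,
      [&& path e y p, uniq (y :: p) & all [in deg2 e U] (y :: p)]].
  have sp := size_tuple p; move: {p} (tval p) sp pe up pD => [|x1 [|x2 t]] /= sp pe up pD; try lia.
  have pU u : u \in [:: y, x1, x2 & t] -> u \in U by move/pD; rewrite inE => /andP[].
  have yU : y \in U by apply: pU; rewrite mem_head.
  have x1U : x1 \in U by apply: pU; rewrite !inE eqxx orbT.
  have x2U : x2 \in U by apply: pU; rewrite !inE eqxx !orbT.
  have [e01 e12 _] := and3P pe.
  have y2 : y != x2 by move: up; rewrite !inE !negb_or => /andP[/and3P[]].
  have d1 : #|nbr e U x1| = 2.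
    by have := pD x1; rewrite !inE eqxx orbT => /(_ isT) /andP[_ /eqP].
  have lt : #|U :\ x1| < #|U| by apply/proper_card/properD1.
  have [||||||f fE] := IH (suppress e y x2) (U :\ x1).
  - exact: leq_trans lt Um.
  - exact: suppress_sym.
  - exact: suppress_irr.
  - exact: (cut_connected_suppress es ei yU x2U x1U e01 e12 y2 d1).
  - exact: degsum_suppress.
  - exact: leq_trans (ltnW lt) Un.
  have sk : 3 * k <= size (x2 :: t) by move: sp; clear; rewrite /=; lia.
  exact: (embeds_unsuppress Rs es ei nb pe up pD sk fE (leq_trans Un (outside f x1 x1U))).
have leafy : #|U| <= (6 * k + 3) * (2 * #|leaves e U| + 3 * q).
  have -> : 6 * k + 3 = 2 * (3 * k + 2) - 1 by clear; lia.
  have [U1 rU] : 1 < #|U| /\ 3 * k + 2 <= #|U| by move: Ubig; clear; lia.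
  apply: card_le_of_no_long_path => //; first by rewrite addnS.
  move=> y p pe up pD sp; case/negP: noP; apply/existsP; exists y.
  have sp' : size p == 3 * k + 1 by rewrite sp addnS.
  by apply/existsP; exists (Tuple sp'); rewrite pe up; apply/allP.
have [L0 cases] := many_leaves big' Un leafy.
have /card_gt0P [l lL] := L0.
have lU : l \in U by move: lL; rewrite inE => /andP[].
have lt : #|U :\ l| < #|U| by apply/proper_card/properD1.
have [||||f fE] := IH e (U :\ l) _ es ei.
- exact: leq_trans lt Um.
- exact: cut_connected_leaf.
- exact: degsum_leaf.
- exact: leq_trans (ltnW lt) Un.
have [//|nA] := leaf_alternative Rs es ei nb lL fE.
have [A' [AA cA']] := near_red_subset (outside f l lU).
have cC := cardsC A'.
have cA3 : 3 * k <= #|~: A'| by move: cC cA' n34 cardV k_gt0; clear; lia.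
have U2 : 2 < #|U| by move: Ubig; clear; lia.
apply: (@embeds_near_red _ _ _ _ Rs es ei k q A'); rewrite ?cA' //.
- exact: near_redS nA.
- exact: cut_connected_sparse.
Qed.

End Main.

(** * Ramsey numbers *)

Lemma degsum_edges (G : sgraph) : degsum (@adj G) setT <= 2 * #|edges G|.
Proof.
apply: (@leq_trans (\sum_(u in [set: G]) \sum_(s in edges G) (u \in s : nat))); last first.
  rewrite exchange_big /= mulnC -sum_nat_const; apply: leq_sum => s.
  rewrite inE => /existsP [x /existsP [y /andP[_ /eqP ->]]].
  rewrite -big_mkcondr /= sum1_card; apply: (@leq_trans #|[set x; y]|); last by rewrite cards2; case: (_ != _).
  by apply: subset_leq_card; apply/subsetP => z /andP[].
apply: leq_sum => u _; rewrite -big_mkcondr /= sum1_card.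
rewrite -(card_in_imset (f := fun w => [set u; w])).
  apply: subset_leq_card; apply/subsetP => s /imsetP [w]; rewrite inE => /andP[_ uw] ->.
  rewrite unfold_in /= set21 andbT inE; apply/existsP; exists u; apply/existsP; exists w.
  by rewrite uw eqxx.
move=> w w'; rewrite !inE => /andP[_ uw] _ /setP /(_ w); rewrite !inE eqxx orbT.
have -> : w == u = false by apply: contraTF uw => /eqP ->; rewrite adj_irr.
by move/esym/eqP.
Qed.

Lemma connected_cut (G : sgraph) : connected G -> cut_connected (@adj G) setT.
Proof.
move=> [_ cG] K _ /set0Pn [x xK] Kc; apply/setP => y; rewrite inE.
have cl : closed adj (mem K).
  apply: intro_closed; first exact/sym_connect_sym/adj_sym.
  by move=> u w uw uK; apply: (Kc u).
by have := closed_connect cl (cG x y); rewrite /= => <-.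
Qed.

Lemma excess_le (n E W : nat) : 0 < W ->
  ((E%:R : rat) <= n%:R * (1 + 1 / W%:R))%R -> (E - n) * W <= n.
Proof.
move=> W0 le; suff : E * W <= n * W + n by rewrite mulnBl; lia.
rewrite -(ler_nat rat) natrD !natrM.
have W0' : (0 < W%:R :> rat)%R by rewrite ltr0n.
move: le; rewrite -(ler_pM2r W0') -mulrA mulrDl mul1r mul1r mulVf ?mulrDr ?mulr1 //.
exact: lt0r_neq0.
Qed.

Lemma book_copy (N k : nat) (c : {set 'I_N} -> bool) (x y : 'I_N) :
  let B := blue (@colour_adj N c true) in
  B x y -> k <= #|nbr B setT x :&: nbr B setT y| -> contains_copy (book k) (blue_graph c).
Proof.
move=> B bxy kC; set C := _ :&: _ in kC.
have Badj u w : B u w -> colour_adj c false u w.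
  by rewrite /B /blue /colour_adj /= /complete_adj; case: (u != w) => //=; case: (c _).
have Cn (i : 'I_k) : nth x (enum C) i \in C.
  by rewrite -mem_enum mem_nth // -cardE; apply: leq_trans (ltn_ord i) kC.
have Cx (i : 'I_k) : B x (nth x (enum C) i) by have := Cn i; rewrite !inE => /andP[].
have Cy (i : 'I_k) : B y (nth x (enum C) i) by have := Cn i; rewrite !inE => /andP[].
pose h (i : 'I_2) := if i == ord0 then x else y.
have hB i j : B (h i) (nth x (enum C) (j : 'I_k)) by rewrite /h; case: ifP.
have xny : x != y by case/andP: bxy.
have h2 (i j : 'I_2) : i != j -> B (h i) (h j).
  have Bs : symmetric B := blue_sym (@colour_sym N c true).
  case: i j => [[|[|i]] Hi] [[|[|j]] Hj] //= _; rewrite /h -!val_eqE //=; by rewrite Bs.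
exists (fun v : book k => match v with inl i => h i | inr i => nth x (enum C) i end).
- move=> [i|i] [j|j] /= E.
  + congr inl; apply/eqP; apply: contraT => /h2; by rewrite E /B /blue eqxx.
  + by have := hB i j; rewrite E /B /blue eqxx.
  + by have := hB j i; rewrite E /B /blue eqxx.
  + have ltC (u : 'I_k) : u < size (enum C) by rewrite -cardE; apply: leq_trans (ltn_ord u) kC.
    by move: E => /eqP; rewrite nth_uniq ?enum_uniq // => /eqP /val_inj ->.
- move=> [i|i] [j|j] /= a.
  + exact/Badj/h2.
  + exact/Badj.
  + by rewrite colour_sym; apply/Badj.
  + by move: a; rewrite /compl_adj /= /complete_adj andbN.
Qed.

Lemma arrows_sparse_book (k n : nat) (G : sgraph) : 0 < k -> 34 * k ^ 3 <= n ->
  connected G -> #|G| = n -> (#|edges G| - n) * (119 * k ^ 2 + 62 * k) <= n ->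
  arrows (2 * n - 1) G (book k).
Proof.
move=> k0 nk cG Gn eG c; set R := @colour_adj _ c true.
have [/existsP [x /existsP [y /andP[bxy kC]]]|nb] :=
    boolP [exists x, exists y, blue R x y && (k <= #|nbr (blue R) setT x :&: nbr (blue R) setT y|)].
  by right; apply: book_copy kC.
left; have [|||||||f [finj _ fR]] := @sparse_connected_embeds G _ R k n (#|edges G| - n)
    (@colour_sym _ c true) _ k0 _ nk eG (@adj G) setT.
- move=> x y bxy; rewrite ltnNge; apply: contra nb => kC.
  by apply/existsP; exists x; apply/existsP; exists y; rewrite bxy.
- exact: card_ord.
- exact: adj_sym.
- exact: adj_irr.
- exact: connected_cut.
- by apply: leq_trans (degsum_edges G) _; rewrite cardsT Gn; lia.
- by rewrite cardsT Gn.
exists f; first by move=> x y; apply: finj; rewrite inE.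
by move=> x y; apply: fR; rewrite inE.
Qed.

Lemma card_le_interval (G : finType) (N a b : nat) (f : G -> 'I_N) : injective f ->
  (forall x, a <= f x < a + b) -> #|G| <= b.
Proof.
move=> fi fab; rewrite -(size_iota a b) cardE -(size_map (val \o f)).
apply: uniq_leq_size.
  by rewrite map_inj_uniq ?enum_uniq // => x y /val_inj /fi.
by move=> v /mapP [x _ ->]; rewrite mem_iota fab.
Qed.

Lemma not_arrows_book (k n M : nat) (G : sgraph) : 0 < k -> 0 < n ->
  connected G -> #|G| = n -> arrows M G (book k) -> 2 * n - 1 <= M.
Proof.
move=> k0 n0 cG Gn ar; rewrite leqNgt; apply/negP => Mn.
pose side (a : 'I_M) := a < n.-1.
pose c (s : {set 'I_M}) := [forall a in s, forall b in s, side a == side b].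
have cE x y : c [set x; y] = (side x == side y).
  apply/idP/eqP => [/forall_inP /(_ x (set21 _ _)) /forall_inP /(_ y (set22 _ _)) /eqP //|s].
  by apply/forall_inP => a /set2P[] ->; apply/forall_inP => b /set2P[] ->; rewrite ?s.
have [[f finj fR]|[f finj fB]] := ar c.
  have [/card_gt0P [x _] con] := cG.
  have fs y : side (f y) = side (f x).
    have cl : closed (@adj G) [pred z | side (f z) == side (f x)].
      apply: intro_closed; first exact/sym_connect_sym/adj_sym.
      by move=> u w uw; rewrite !inE => /eqP <-; have := fR _ _ uw => /andP[_]; rewrite cE eqb_id eq_sym.
    by have := closed_connect cl (con x y); rewrite !inE eqxx => /esym /eqP.
  case sx : (side (f x)).
    have : #|G| <= n.-1.
      by apply: (@card_le_interval _ _ 0 _ f) => // y; rewrite -[X in _ < X]/n.-1; exact: etrans (fs y) sx.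
    by rewrite Gn; lia.
  have : #|G| <= M - n.-1.
    apply: (@card_le_interval _ _ n.-1 _ f) => // y.
    by have := etrans (fs y) sx; rewrite /side; have := ltn_ord (f y); lia.
  by rewrite Gn; lia.
pose v0 : book k := inl ord0; pose v1 : book k := inl ord_max.
pose v2 : book k := inr (Ordinal k0).
have ns u w : adj u w -> side (f u) != side (f w).
  by move=> /fB /andP[_]; rewrite cE => /eqP ->.
have := ns v0 v1 isT; have := ns v0 v2 isT; have := ns v1 v2 isT.
by case: (side _) (side _) (side _) => [] [] [].
Qed.

Theorem theorem1p8 (k n : nat) (G : sgraph)
    (k_gt0 : 0 < k)
    (n_ge : 34 * k ^ 3 <= n)
    (G_conn : connected G)
    (G_card : #|G| = n)
    (G_edges : ((#|edges G|%:R : rat) <=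
                n%:R * (1 + 1 / (119 * k ^ 2 + 62 * k)%N%:R))%R) :
  is_ramsey_number G (book k) (2 * n - 1).
Proof.
have n0 : 0 < n by case: G_conn; rewrite G_card.
split; first by lia.
  apply: arrows_sparse_book => //; apply: excess_le => //.
  by rewrite addn_gt0 [0 < 62 * k]muln_gt0 k_gt0 orbT.
by move=> M _; apply: not_arrows_book.
Qed.
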